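(* Let $n,m,p$ be positive integers and let $\mathscr{M}$ be a bounded subset of $M_n(\mathbb{R})\times M_{n,m}(\mathbb{R})\times M_{p,n}(\mathbb{R})$. For $\tau\ge0$ let $\gamma_2(\tau)\in[0,\infty]$ be the $L_2$-gain of the switched linear control system $\dot x=A(t)x+B(t)u$, $y=C(t)x$, $(A,B,C)\in\mathcal{S}^{{\rm d},\tau}(\mathscr{M})$. Then the function $\gamma_2:[0,\infty)\to[0,\infty]$ is right-continuous, i.e., for every $\bar\tau\in[0,\infty)$, $\lim_{\tau\searrow\bar\tau}\gamma_2(\tau)=\gamma_2(\bar\tau)$.
   Context: A signal on $[0,\infty)$ is piecewise constant if on every finite interval it has finitely many discontinuities and takes finitely many values. $\mathcal{S}^{{\rm d},\tau}(\mathscr{M})$ is, for $\tau>0$, the class of piecewise constant $\mathscr{M}$-valued signals on $[0,\infty)$ such that the distance between any two switching times is at least $\tau$; for $\tau=0$ it is the class of all piecewise constant $\mathscr{M}$-valued signals. The $L_2$-gain is $\gamma_2(\tau)=\sup\{\|y_{u,\sigma}\|_2/\|u\|_2\mid u\in L_2([0,\infty),\mathbb{R}^m)\setminus\{0\},\ \sigma\in\mathcal{S}^{{\rm d},\tau}(\mathscr{M})\}$, where $y_{u,\sigma}$ is the output corresponding to input $u$, switching law $\sigma$ and initial condition $x(0)=0$. *)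

(* Defs.v *)
From HB Require Import structures.
From mathcomp Require Import all_boot all_order all_algebra.
From mathcomp Require Import all_classical all_reals all_analysis.
Import Order.TTheory GRing.Theory Num.Theory.
Import numFieldNormedType.Exports.

Set Implicit Arguments.
Unset Strict Implicit.
Unset Printing Implicit Defensive.

Local Open Scope classical_set_scope.
Local Open Scope ring_scope.

(** Throughout, a signal on [0, +oo) is a total function on [R]; its values at
    negative times are never inspected. *)
Notation time R := (`[0%R, +oo[%classic : set R).

Section switching_signals.
Context {R : realType} {V : topologicalType}.
Implicit Types (sigma : R -> V) (M : set V) (tau : R).

(** Continuity is relative to [0, +oo): at the time 0 it is right-continuity. *)
Definition switching_times sigma : set R :=
  [set t | time R t /\ ~ sigma s @[s --> within (time R) (nbhs t)] --> sigma t].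

(** Every finite interval of [0, +oo) is contained in some [0, T]. *)
Definition piecewise_constant sigma : Prop :=
  forall T : R, finite_set (switching_times sigma `&` `[0, T]) /\
                finite_set (sigma @` `[0, T]).

(** For [tau = 0] the dwell-time condition is vacuous, so that this is the class
    of all the piecewise constant [M]-valued signals. *)
Definition dwell_time_signals tau M : set (R -> V) :=
  [set sigma | [/\ piecewise_constant sigma,
    forall t, time R t -> M (sigma t) &
    forall s t, switching_times sigma s -> switching_times sigma t ->
      s != t -> tau <= `|s - t|]].

End switching_signals.

Section L2_gain.
Context {R : realType}.
Local Notation mu := (@lebesgue_measure R).

(** The library norm of a matrix is the max norm, hence this definition. *)
Definition euclidean_norm k (v : 'cV[R]_k) : R :=
  Num.sqrt (\sum_(i < k) v i ord0 ^+ 2).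

Definition L2_norm k (f : R -> 'cV[R]_k) : \bar R :=
  'N[mu]_2%:E[EFin \o ((@euclidean_norm k \o f) \_ (time R))].

Definition in_L2 k (f : R -> 'cV[R]_k) : Prop :=
  (forall i, measurable_fun (time R) (fun t => f t i ord0)) /\
  (L2_norm f < +oo)%E.

Variables n m p : nat.

Local Notation system := ('M[R]_n * 'M[R]_(n, m) * 'M[R]_(p, n))%type.
Implicit Types (S : system) (sigma : R -> system) (M : set system).

Definition matA S := S.1.1.
Definition matB S := S.1.2.
Definition matC S := S.2.

(** [x] is the Caratheodory solution of x' = A x + B u, x(0) = 0, in integral
    form: for [sigma] piecewise constant and [u] in L_2 the integrand is
    integrable on each [0, t], and such an [x] exists and is unique on
    [0, +oo). *)
Definition trajectory sigma (u : R -> 'cV[R]_m) (x : R -> 'cV[R]_n) : Prop :=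
  {within time R, continuous x} /\
  forall t, time R t -> forall i, x t i ord0 =
    \int[mu]_(s in `[0, t])
      (matA (sigma s) *m x s + matB (sigma s) *m u s) i ord0.

Definition output sigma (x : R -> 'cV[R]_n) : R -> 'cV[R]_p :=
  fun t => matC (sigma t) *m x t.

Definition L2_ratios M (tau : R) : set (\bar R) :=
  [set r | exists u sigma x,
    [/\ in_L2 u, ~ {ae mu, forall t, time R t -> u t = 0},
        dwell_time_signals tau M sigma, trajectory sigma u x &
        r = (L2_norm (output sigma x) / L2_norm u)%E]].

(** The supremum is taken in [0, +oo], so it is 0 when [M] is empty. *)
Definition L2_gain M (tau : R) : \bar R :=
  maxe 0%E (ereal_sup (L2_ratios M tau)).

End L2_gain.

(* Main.v *)
(** Lower semicontinuity does the work, since the gain is nonincreasing in the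
    dwell time.  Given an input [u] and a signal [sigma] with dwell time
    [taubar], freeze [sigma] after a long time [T], so that it has finitely many
    switching times, with a positive minimal gap, and slow it down by a factor
    [1 / c > 1]: the new signal [t |-> sigma (min (c * t) T)] has a dwell time
    [> taubar], even when [taubar = 0].  As [c] tends to 1 and [T] to infinity
    the new signals converge to [sigma] off its countably many switching times.
    The input is kept unchanged; by dominated convergence and a Gronwall-type
    estimate the trajectories converge pointwise, and Fatou's lemma bounds the
    norm of the output for [sigma] by those of the approximating outputs. *)
Require Import Defs.
From HB Require Import structures.
From mathcomp Require Import all_boot all_order all_algebra.
From mathcomp Require Import all_classical all_reals all_analysis.
From mathcomp Require Import measurable_realfun ring lra.
Import Order.TTheory GRing.Theory Num.Theory.
Import numFieldNormedType.Exports.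

Set Implicit Arguments.
Unset Strict Implicit.
Unset Printing Implicit Defensive.

Local Open Scope classical_set_scope.
Local Open Scope ring_scope.

(** * Integrability on segments *)

Section segment_integrability.
Context {R : realType}.
Local Notation mu := (@lebesgue_measure R).
Implicit Types (f g b : R -> R) (t T : R).

(** Local integrability on the half-line; for negative [T] the segment is empty and the condition is
    void. *)
Definition segment_integrable g :=
  forall T, mu.-integrable `[0, T] (EFin \o g).

Lemma time_segment T : `[0, T] `<=` time R.
Proof. by move=> t /=; rewrite !in_itv/= => /andP[->]. Qed.

Lemma timeE t : time R t = (0 <= t).
Proof. by rewrite /= in_itv/= andbT. Qed.

Lemma segment_integrable_measurable g T :
  segment_integrable g -> measurable_fun `[0, T] g.
Proof. by move=> /(_ T)/measurable_int/measurable_EFinP. Qed.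

Lemma segment_integrableD f g : segment_integrable f ->
  segment_integrable g -> segment_integrable (fun t => f t + g t).
Proof.
move=> lf lg T.
rewrite (_ : EFin \o _ = ((EFin \o f) \+ (EFin \o g))%E)//.
exact: integrableD.
Qed.

Lemma segment_integrable_sum I (r : seq I) (P : pred I) (h : I -> R -> R) :
  (forall i, segment_integrable (h i)) ->
  segment_integrable (fun t => \sum_(i <- r | P i) h i t).
Proof.
move=> lh T.
rewrite (_ : EFin \o _ = fun t => (\sum_(i <- r | P i) (h i t)%:E)%E).
  by apply: integrable_sum => // i _; exact: lh.
by apply/funext => t/=; rewrite sumEFin.
Qed.

Lemma segment_integrableM (K : R) b g : measurable_fun (time R) b ->
  (forall t, 0 <= t -> `|b t| <= K) ->
  segment_integrable g -> segment_integrable (fun t => b t * g t).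
Proof.
move=> mb bK lg T.
rewrite (_ : EFin \o _ = ((EFin \o b) \* (EFin \o g))%E)//.
apply: integrableMr => //.
  by apply: measurable_funS mb => //; exact: time_segment.
exists K; split; first exact: num_real.
move=> M KM t /time_segment; rewrite timeE => t0.
exact: le_trans (bK _ t0) (ltW KM).
Qed.

Lemma time_continuous_measurable f :
  {within time R, continuous f} -> measurable_fun (time R) f.
Proof. by move=> cf; exact: subspace_continuous_measurable_fun. Qed.

Lemma time_continuous_segment_integrable f :
  {within time R, continuous f} -> segment_integrable f.
Proof.
move=> cf T; apply: continuous_compact_integrable.
  exact: segment_compact.
exact: continuous_subspaceW (@time_segment T) cf.
Qed.

Lemma time_continuous_integral g : segment_integrable g ->
  {within time R, continuous (fun t => \int[mu]_(s in `[0, t]) g s)}.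
Proof.
move=> lg; apply/subspace_continuousP => t; rewrite timeE => t0.
(* The endpoint [t + 1] keeps [t] away from the right end of the segment, so that near [t] the
   segment and the half-line coincide. *)
have t1 : 0 <= t + 1 by rewrite addr_ge0.
have := @parameterized_integral_continuous _ _ _ _ t1 (lg (t + 1)).
move=> /subspace_continuousP /(_ t) /=.
rewrite in_itv/= t0 lerDl ler01 => /(_ isT); apply: cvg_trans.
apply: cvg_app => A nA.
change (\forall s \near t, `[0, t + 1]%classic s -> A s) in nA.
change (\forall s \near t, time R s -> A s).
near=> s; rewrite timeE => s0.
have : `[0, t + 1]%classic s -> A s by near: s.
apply; rewrite /= in_itv/= s0/=.
by apply/ltW; near: s; apply: lt_nbhsl; rewrite ltrDl.
Unshelve. all: by end_near. Qed.

End segment_integrability.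

(** * Linear Volterra equations *)

Section volterra.
Context {R : realType}.
Local Notation mu := (@lebesgue_measure R).

(** The antiderivative is [expR (c * s)] itself; keeping the factor [c] under the integral covers
    [c = 0] without a division. *)
Lemma integral_scaled_expR (c t : R) : 0 <= t ->
  \int[mu]_(s in `[0, t]) (c * expR (c * s)) = expR (c * t) - 1.
Proof.
rewrite le_eqVlt => /predU1P[<-|t0].
  by rewrite set_itv1 Rintegral_set1 mulr0 expR0 subrr.
have cexp : continuous (fun s : R => expR (c * s)).
  move=> s; apply: (@continuous_comp _ _ _ (fun s => c * s) expR).
    exact: mulrl_continuous.
  exact: continuous_expR.
have dexp (s : R) : is_derive s 1 (fun s : R => expR (c * s))
    (c * expR (c * s)).
  apply: is_derive_eq.
  by rewrite /GRing.scale/= mulr1 mulrC.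
rewrite /Rintegral (@continuous_FTC2 _ _ (fun s => expR (c * s)) 0 t) //.
- by rewrite mulr0 expR0.
- apply: continuous_subspaceT => s; apply: cvgM; first exact: cvg_cst.
  exact: cexp.
- split.
  + by move=> s _; have [] := dexp s.
  + exact/cvg_at_right_filter/cexp.
  + exact/cvg_at_left_filter/cexp.
- by move=> s _; rewrite derive1E; have [_ ->] := dexp s.
Qed.

Definition bounded_coefficients m n (K : R) (a : R -> 'M[R]_(m, n)) :=
  forall i j, measurable_fun (time R) (fun t => a t i j) /\
              forall t, 0 <= t -> `|a t i j| <= K.

Lemma segment_integrable_mulmx m n K (a : R -> 'M[R]_(m, n))
    (v : R -> 'cV[R]_n) i : bounded_coefficients K a ->
  (forall j, segment_integrable (fun t => v t j ord0)) ->
  segment_integrable (fun t => (a t *m v t) i ord0).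
Proof.
move=> aK lv.
rewrite (_ : (fun t => _) = (fun t => \sum_j a t i j * v t j ord0)).
  apply: segment_integrable_sum => j.
  by have [ma aij] := aK i j; exact: segment_integrableM ma aij (lv j).
by apply/funext => t; rewrite mxE.
Qed.

Lemma norm_mulmx_le m n (K G : R) (a : 'M[R]_(m, n)) (v : 'cV[R]_n) i :
  (forall j, `|a i j| <= K) -> (forall j, `|v j ord0| <= G) ->
  `|(a *m v) i ord0| <= n%:R * K * G.
Proof.
move=> aK vG; rewrite mxE (le_trans (ler_norm_sum _ _ _))//.
rewrite (@le_trans _ _ (\sum_(j < n) K * G))//.
  by apply: ler_sum => j _; rewrite normrM ler_pM// ?aK ?vG.
by rewrite sumr_const card_ord -mulrA mulr_natl.
Qed.

Lemma cvg_sumr T (F : set_system T) I (r : seq I) (h : I -> T -> R)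
    (l : I -> R) : Filter F ->
  (forall i, h i x @[x --> F] --> l i) ->
  \sum_(i <- r) h i x @[x --> F] --> \sum_(i <- r) l i.
Proof.
move=> FF hl; elim: r => [|i r IH].
  by rewrite big_nil; under eq_cvg do rewrite big_nil; exact: cvg_cst.
rewrite big_cons; under eq_cvg do rewrite big_cons.
by apply: cvgD => //; exact: hl.
Qed.

Lemma cvg_mulmx m n (u : nat -> 'cV[R]_n) (v : 'cV[R]_n)
    (b : nat -> 'M[R]_(m, n)) (b' : 'M[R]_(m, n)) i :
  (forall j, b k i j @[k --> \oo] --> b' i j) ->
  (forall j, u k j ord0 @[k --> \oo] --> v j ord0) ->
  (b k *m u k) i ord0 @[k --> \oo] --> (b' *m v) i ord0.
Proof.
move=> bb' uv; rewrite mxE.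
rewrite (_ : (fun k => _) = fun k => \sum_j b k i j * u k j ord0); last first.
  by apply/funext => k; rewrite mxE.
apply: cvg_sumr => j; apply: cvgM; [exact: bb'|exact: uv].
Qed.

Lemma Rintegral_dominated_cvg d (T : measurableType d)
    (nu : {measure set T -> \bar R}) (D : set T) (f_ : nat -> T -> R)
    (f g : T -> R) :
  measurable D -> (forall k, measurable_fun D (f_ k)) -> measurable_fun D f ->
  {ae nu, forall t, D t -> f_ k t @[k --> \oo] --> f t} ->
  nu.-integrable D (EFin \o g) ->
  (forall k t, D t -> `|f_ k t| <= g t) ->
  \int[nu]_(t in D) f_ k t @[k --> \oo] --> \int[nu]_(t in D) f t.
Proof.
move=> mD mf_ mf cf ig fg.
have [] := @dominated_convergence _ _ _ nu D mD (fun k => EFin \o f_ k)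
  (EFin \o f) (EFin \o g).
- by move=> k; apply/measurable_EFinP; exact: mf_.
- exact/measurable_EFinP.
- by apply: filterS cf => t cft Dt; apply: cvg_EFin; [exact: nearW|exact: cft].
- exact: ig.
- by apply: aeW => t k Dt; rewrite lee_fin fg.
move=> fi _ cvi; apply: fine_cvg.
by rewrite fineK//; exact: integrable_fin_num.
Qed.

(** * Neumann series of a Volterra equation *)

Variables (n : nat) (K : R) (a : R -> 'M[R]_n) (f : R -> 'cV[R]_n).
Hypothesis aK : bounded_coefficients K a.
Hypothesis cf : forall i, {within time R, continuous (fun t => f t i ord0)}.

Let integral_op (v : R -> 'cV[R]_n) t : 'cV[R]_n :=
  \col_i \int[mu]_(s in `[0, t]) (a s *m v s) i ord0.

(** Terms of the Neumann series of [w = f + integral_op w]; their sum is the solution. *)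
Let d k := iter k integral_op f.

Let cd k i : {within time R, continuous (fun t => d k t i ord0)}.
Proof.
elim: k i => [|k IH] i //=.
rewrite (_ : (fun t => _) =
    fun t => \int[mu]_(s in `[0, t]) (a s *m d k s) i ord0); last first.
  by apply/funext => t; rewrite mxE.
apply: time_continuous_integral; apply: segment_integrable_mulmx aK _ => j.
exact/time_continuous_segment_integrable/IH.
Qed.

Let ld k i : segment_integrable (fun t => d k t i ord0).
Proof. exact/time_continuous_segment_integrable/cd. Qed.

Let c := n%:R * K *+ 2.

(* With the weight [expR (c * t)] the integral operator contracts by a factor 2,
   since [c] is twice the bound [n%:R * K] of its kernel. *)
Let d_bound T G : (forall t i, 0 <= t <= T -> `|f t i ord0| <= G) ->
  forall k t i, 0 <= t <= T -> `|d k t i ord0| <= G * expR (c * t) / 2 ^+ k.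
Proof.
move=> fG; elim=> [|k IH] t i /andP[t0 tT] /=.
  rewrite expr0 divr1.
  have G0 : 0 <= G by apply: le_trans (fG t i _); rewrite ?t0.
  rewrite (le_trans (fG t i _)) ?t0// ler_peMr// -expR0 ler_expR.
  rewrite mulr_ge0// mulrn_wge0// mulr_ge0//.
  (* [K] is nonnegative because it bounds the norm of a coefficient; the index [i] guarantees that
     there is one. *)
  have [_ /(_ 0 (lexx _))] := aK i i.
  exact: le_trans.
rewrite /integral_op mxE.
have li : mu.-integrable `[0, t] (EFin \o (fun s => (a s *m d k s) i ord0)).
  exact: segment_integrable_mulmx aK (ld k) t.
have le : mu.-integrable `[0, t] (EFin \o (fun s => c * expR (c * s))).
  apply: continuous_compact_integrable; first exact: segment_compact.
  apply: continuous_subspaceT => s; apply: cvgM; first exact: cvg_cst.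
  apply: (@continuous_comp _ _ _ (fun s => c * s) expR).
    exact: mulrl_continuous.
  exact: continuous_expR.
rewrite (le_trans (le_normr_Rintegral _ _))//.
(* Since [n%:R * K = c / 2], the induction hypothesis bounds the integrand by this multiple of
   [c * expR (c * s)], whose integral is explicit; the factor 1/2 is the gain of one iteration. *)
rewrite (@le_trans _ _ (\int[mu]_(s in `[0, t])
    ((G / 2 ^+ k.+1) * (c * expR (c * s)))))//.
  apply: le_Rintegral => //.
  - exact: integrable_norm li.
  - have := @integrableZl _ _ _ mu `[0, t] _ (G / 2 ^+ k.+1) _ le.
    by apply; exact: measurable_itv.
  move=> s; rewrite /= in_itv/= => /andP[s0 st].
  rewrite (le_trans (norm_mulmx_le (K := K)
    (G := G * expR (c * s) / 2 ^+ k) _ _))//.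
  - by move=> j; have [_ ] := aK i j; apply.
  - by move=> j; apply: IH; rewrite s0 (le_trans st).
  - rewrite /c exprS.
    have : (2 : R) ^+ k != 0 by rewrite expf_neq0.
    set u := 2 ^+ k; set v := expR _ => u0.
    rewrite le_eqVlt; apply/orP; left; apply/eqP.
    by field.
rewrite RintegralZl// integral_scaled_expR//.
have G0 : 0 <= G by apply: le_trans (fG t i _); rewrite ?t0.
rewrite mulrBr mulr1 mulrAC lerBlDr lerDl.
by rewrite divr_ge0.
Qed.

Let S k t : 'cV[R]_n := \sum_(j < k) d j t.

Let SE k t i : S k t i ord0 = series (fun k => d k t i ord0) k.
Proof. by rewrite seriesEord /S summxE. Qed.

(** By linearity the partial sums of the Neumann series are Picard iterates; the integral equation
    for [w] is the limit of this recursion. *)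
Let S_rec k t i : S k.+1 t i ord0 =
  f t i ord0 + \int[mu]_(s in `[0, t]) (a s *m S k s) i ord0.
Proof.
have lS l j : segment_integrable (fun t => S l t j ord0).
  rewrite (_ : (fun t => _) = (fun t => \sum_(m < l) d m t j ord0)).
    exact: segment_integrable_sum.
  by apply/funext => s; rewrite /S summxE.
elim: k => [|k IH].
  rewrite /S big_ord_recl !big_ord0 addr0/=.
  under eq_Rintegral do rewrite big_ord0 mulmx0 mxE.
  by rewrite Rintegral_cst// mul0r addr0.
rewrite /S big_ord_recr mxE -/(S k.+1 t) IH/= /integral_op mxE -addrA.
congr (_ + _); rewrite -RintegralD//; last 2 first.
- exact: segment_integrable_mulmx aK (lS k) t.
- exact: segment_integrable_mulmx aK (ld k) t.
by apply: eq_Rintegral => s _; rewrite big_ord_recr mulmxDr [RHS]mxE.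
Qed.

Let f_bound T : exists G, forall t i, 0 <= t <= T -> `|f t i ord0| <= G.
Proof.
have fi i : exists G, forall t, 0 <= t <= T -> `|f t i ord0| <= G.
  have cfT : {within `[0, T], continuous (fun t => f t i ord0)}.
    apply: continuous_subspaceW (@cf i); exact: time_segment.
  have := continuous_compact cfT (@segment_compact R 0 T).
  move=> /compact_bounded [M [_ /(_ (M + 1))]]; rewrite ltrDl => /(_ ltr01) fM.
  exists (M + 1) => t t0T; apply: fM; exists t => /=.
    by rewrite in_itv.
  by [].
have [G fG] := choice fi.
exists (\sum_i `|G i|) => t i t0T.
rewrite (le_trans (fG i t t0T))// (bigD1 i)//= (le_trans (ler_norm _))//.
by rewrite lerDl sumr_ge0.
Qed.

(** Summing the geometric bounds of [d_bound] costs a factor 2. Uniformity in [k] provides both a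
    dominating constant and the Gronwall estimate for the limit. *)
Let S_bound T G : (forall t i, 0 <= t <= T -> `|f t i ord0| <= G) ->
  forall k t i, 0 <= t <= T -> `|S k t i ord0| <= 2 * G * expR (c * t).
Proof.
move=> fG k t i t0T.
have G0 : 0 <= G by apply: le_trans (fG t i t0T).
(* The induction needs the exact partial sum of the geometric series, namely [2 * (1 - 2 ^- k)]. *)
have : `|S k t i ord0| <= 2 * G * expR (c * t) * (1 - 2 ^- k).
  elim: k => [|k IH].
    by rewrite /S big_ord0 mxE normr0 expr0 invr1 subrr mulr0.
  rewrite /S big_ord_recr mxE (le_trans (ler_normD _ _))//.
  rewrite (le_trans (lerD IH (d_bound fG k i t0T)))//.
  have : (2 : R) ^+ k != 0 by rewrite expf_neq0.
  rewrite exprS; set u := 2 ^+ k; set v := expR _ => u0.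
  rewrite le_eqVlt; apply/orP; left; apply/eqP.
  by field.
by move/le_trans; apply; rewrite ler_piMr ?mulr_ge0 ?expR_ge0//
  gerBl invr_ge0 exprn_ge0.
Qed.

(** The limit is taken pointwise; the continuity of [w] is recovered afterwards from the integral
    equation. *)
Let w t : 'cV[R]_n := \col_i limn (fun k => S k t i ord0).

Let S_cvg t i : 0 <= t -> S k t i ord0 @[k --> \oo] --> w t i ord0.
Proof.
move=> t0; rewrite /w mxE; suff: cvgn (fun k => S k t i ord0) by [].
have [G fG] := f_bound t.
rewrite (_ : (fun k => _) = series (fun k => d k t i ord0)); last first.
  by apply/funext => k; rewrite SE.
apply: normed_cvg.
apply: (@series_le_cvg _ _ (geometric (G * expR (c * t)) 2^-1)).
- by move=> k /=.
- move=> k /=; rewrite mulr_ge0 ?exprn_ge0 ?mulr_ge0 ?expR_ge0//.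
  by apply: le_trans (fG t i _); rewrite ?t0/=.
- by move=> k /=; rewrite exprVn; apply: (d_bound fG); rewrite t0/=.
- by apply: is_cvg_geometric_series; rewrite ger0_norm// invf_lt1// ltr1n.
Qed.

(** The last clause is a Gronwall estimate, inherited from the partial sums. With [T] and [G]
    arbitrary, it turns a small forcing term on a segment into a small solution there. *)
Lemma volterra_solution : exists w : R -> 'cV[R]_n,
  [/\ forall i, {within time R, continuous (fun t => w t i ord0)},
      forall t i, 0 <= t -> w t i ord0 =
        f t i ord0 + \int[mu]_(s in `[0, t]) (a s *m w s) i ord0 &
      forall T G, (forall t i, 0 <= t <= T -> `|f t i ord0| <= G) ->
        forall t i, 0 <= t <= T ->
          `|w t i ord0| <= 2 * G * expR (n%:R * K *+ 2 * t)].
Proof.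
have lS l j : {within time R, continuous (fun t => S l t j ord0)}.
  rewrite (_ : (fun t => _) = (fun t => \sum_(m < l) d m t j ord0)).
    by move=> t; apply: cvg_sumr => m; apply: cd.
  by apply/funext => s; rewrite /S summxE.
have w_bound T G : (forall t i, 0 <= t <= T -> `|f t i ord0| <= G) ->
    forall t i, 0 <= t <= T -> `|w t i ord0| <= 2 * G * expR (c * t).
  move=> fG t i t0T; have /andP[t0 tT] := t0T.
  have cvS : `|S k t i ord0| @[k --> \oo] --> `|w t i ord0|.
    by apply: cvg_norm; exact: S_cvg.
  rewrite -(cvg_lim (@Rhausdorff R) cvS).
  apply: limr_le; first exact: cvgP cvS.
  by apply: nearW => k; exact: S_bound fG _ _ _ t0T.
(* Measurability as a pointwise limit, together with [w_bound], makes [w] integrable on segments, so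
   that its integral equation can be treated. *)
have mw j : measurable_fun (time R) (fun t => w t j ord0).
  apply: (@measurable_fun_cvg _ _ _ _ (fun k t => S k t j ord0)).
    by move=> k; apply: time_continuous_measurable; exact: lS.
  by move=> t; rewrite timeE => t0; exact: S_cvg.
have lw j : segment_integrable (fun t => w t j ord0).
  move=> T; apply: measurable_bounded_integrable => //.
  - exact: compact_finite_measure (@segment_compact _ _ _).
  - exact: measurable_funS (@time_segment _ T) (mw j).
  have [G fG] := f_bound T.
  (* Passing to the absolute value of [c] makes the exponent nondecreasing in time without
     discussing the sign of [c]. *)
  exists (2 * G * expR (`|c| * T)); split; first exact: num_real.
  move=> M ltM t; rewrite /= in_itv/= => t0T; apply: le_trans (ltW ltM).
  have G0 : 0 <= G by apply: le_trans (fG t j t0T).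
  rewrite (le_trans (w_bound _ _ fG _ _ t0T))// ler_wpM2l ?mulr_ge0//.
  rewrite ler_expR (le_trans (ler_norm _))// normrM ler_wpM2l//.
  by case/andP : t0T => t0 tT; rewrite ger0_norm.
have weq t i : 0 <= t -> w t i ord0 =
    f t i ord0 + \int[mu]_(s in `[0, t]) (a s *m w s) i ord0.
  move=> t0.
  (* The shifted sequence is the left-hand side of [S_rec]; its two limits must agree. *)
  have cvS : S k.+1 t i ord0 @[k --> \oo] --> w t i ord0.
    by rewrite (cvg_shiftS (fun k => S k t i ord0)); exact: S_cvg.
  apply: (cvg_unique (@Rhausdorff R) cvS).
  rewrite (_ : (fun k => _) = fun k => f t i ord0 +
      \int[mu]_(s in `[0, t]) (a s *m S k s) i ord0); last first.
    by apply/funext => k; exact: S_rec.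
  apply: cvgD; first exact: cvg_cst.
  have [G fG] := f_bound t.
  have lSi l j : segment_integrable (fun t => S l t j ord0).
    exact: time_continuous_segment_integrable.
  apply: (@Rintegral_dominated_cvg _ _ mu _ _ _
      (fun=> n%:R * K * (2 * G * expR (`|c| * t)))).
  - exact: measurable_itv.
  - move=> k; apply: segment_integrable_measurable.
    exact: segment_integrable_mulmx aK (lSi k).
  - apply: segment_integrable_measurable.
    exact: segment_integrable_mulmx aK lw.
  - apply: aeW => s /time_segment; rewrite timeE => s0.
    by apply: cvg_mulmx => j; [exact: cvg_cst|exact: S_cvg].
  - apply: continuous_compact_integrable; first exact: segment_compact.
    by apply: continuous_subspaceT => s; exact: cvg_cst.
  - move=> k s; rewrite /= in_itv/= => /andP[s0 st].
    apply: norm_mulmx_le => j.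
      by have [_] := aK i j; apply.
    have G0 : 0 <= G by apply: le_trans (fG s j _); rewrite ?s0.
    rewrite (le_trans (S_bound fG k j _)) ?s0// ler_wpM2l ?mulr_ge0//.
    rewrite ler_expR (le_trans (ler_norm _))// normrM ler_wpM2l//.
    by rewrite ger0_norm.
exists w; split => // i.
(* The right-hand side of the equation is continuous, and [w] equals it on the half-line. *)
have : {within time R, continuous (fun t => f t i ord0 +
    \int[mu]_(s in `[0, t]) (a s *m w s) i ord0)}.
  move=> t; apply: cvgD; first exact: cf.
  apply: time_continuous_integral.
  exact: segment_integrable_mulmx aK lw.
apply: subspace_eq_continuous => t; rewrite inE timeE => t0.
exact/esym/weq.
Qed.

End volterra.

(** * Perturbation of trajectories *)

Section perturbation.
Context {R : realType}.
Local Notation mu := (@lebesgue_measure R).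

Lemma bounded_coefficientsB p q (K' : R) (a b : R -> 'M[R]_(p, q)) :
  bounded_coefficients K' a -> bounded_coefficients K' b ->
  bounded_coefficients (K' *+ 2) (fun t => a t - b t).
Proof.
move=> aK bK i j; have [ma aij] := aK i j; have [mb bij] := bK i j; split.
  rewrite (_ : (fun t => _) = (fun t => a t i j) \- (fun t => b t i j)).
    exact: measurable_funB.
  by apply/funext => t; rewrite !mxE.
move=> t t0; rewrite !mxE (le_trans (ler_normB _ _))// mulr2n.
by rewrite lerD ?aij ?bij.
Qed.

(** Unlike in [norm_mulmx_le], [v] stays on the right: this yields a dominating function when [v] is
    integrable but possibly unbounded, as the input is. *)
Lemma norm_mulmx_sum_le p q (K' : R) (a : 'M[R]_(p, q)) (v : 'cV[R]_q) i :
  (forall j, `|a i j| <= K') ->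
  `|(a *m v) i ord0| <= K' * \sum_j `|v j ord0|.
Proof.
move=> aK; rewrite mxE (le_trans (ler_norm_sum _ _ _))// mulr_sumr.
by apply: ler_sum => j _; rewrite normrM ler_wpM2r.
Qed.

Lemma segment_integrable_sum_norm q (C : R) (v : R -> 'cV[R]_q) :
  (forall j, segment_integrable (fun t => v t j ord0)) ->
  segment_integrable (fun t => C * \sum_j `|v t j ord0|).
Proof.
move=> lv; apply: (@segment_integrableM _ `|C| (fun=> C)) => //.
by apply: segment_integrable_sum => j T; exact/integrable_norm/lv.
Qed.

Lemma segment_integrable_field n p (a : R -> 'M[R]_n) (b : R -> 'M[R]_(n, p))
    (K' : R) (y : R -> 'cV[R]_n) (v : R -> 'cV[R]_p) i :
  bounded_coefficients K' a -> bounded_coefficients K' b ->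
  (forall j, segment_integrable (fun t => y t j ord0)) ->
  (forall j, segment_integrable (fun t => v t j ord0)) ->
  segment_integrable (fun t => (a t *m y t + b t *m v t) i ord0).
Proof.
move=> aK bK ly lv.
rewrite (_ : (fun t => _) =
    fun t => (a t *m y t) i ord0 + (b t *m v t) i ord0); last first.
  by apply/funext => t; rewrite mxE.
by apply: segment_integrableD;
  [exact: segment_integrable_mulmx aK ly|exact: segment_integrable_mulmx bK lv].
Qed.

Variables (n m : nat) (K : R) (u : R -> 'cV[R]_m) (x : R -> 'cV[R]_n).
Variables (A : R -> 'M[R]_n) (B : R -> 'M[R]_(n, m)).
Hypotheses (AK : bounded_coefficients K A) (BK : bounded_coefficients K B).
Hypothesis lu : forall j, segment_integrable (fun t => u t j ord0).
Hypothesis cx : forall i, {within time R, continuous (fun t => x t i ord0)}.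
Hypothesis xE : forall t i, 0 <= t -> x t i ord0 =
  \int[mu]_(s in `[0, t]) (A s *m x s + B s *m u s) i ord0.

Let lx j : segment_integrable (fun t => x t j ord0).
Proof. exact/time_continuous_segment_integrable/cx. Qed.

(* The difference [z - x] is constructed as the solution of a Volterra equation,
   so that the estimate does not rely on the uniqueness of trajectories. *)
Lemma perturbed_trajectory (A' : R -> 'M[R]_n) (B' : R -> 'M[R]_(n, m)) :
  bounded_coefficients K A' -> bounded_coefficients K B' ->
  exists z : R -> 'cV[R]_n,
  [/\ forall i, {within time R, continuous (fun t => z t i ord0)},
      forall t i, 0 <= t -> z t i ord0 =
        \int[mu]_(s in `[0, t]) (A' s *m z s + B' s *m u s) i ord0 &
      forall T G, (forall t i, 0 <= t <= T ->
        `|\int[mu]_(s in `[0, t])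
            ((A' s - A s) *m x s + (B' s - B s) *m u s) i ord0| <= G) ->
        forall t i, 0 <= t <= T ->
          `|z t i ord0 - x t i ord0| <= 2 * G * expR (n%:R * K *+ 2 * t)].
Proof.
move=> A'K B'K.
have ldiff i : segment_integrable (fun s =>
    ((A' s - A s) *m x s + (B' s - B s) *m u s) i ord0).
  by apply: (segment_integrable_field _ (bounded_coefficientsB A'K AK)
    (bounded_coefficientsB B'K BK)).
(* [f] is the integrated defect of [x] in the perturbed equation; the correction [w = z - x] must
   satisfy the Volterra equation with kernel [A'] and forcing [f]. *)
pose f t : 'cV[R]_n := \col_i \int[mu]_(s in `[0, t])
  ((A' s - A s) *m x s + (B' s - B s) *m u s) i ord0.
have fE t i : f t i ord0 = \int[mu]_(s in `[0, t])
  ((A' s - A s) *m x s + (B' s - B s) *m u s) i ord0 by rewrite mxE.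
have cf i : {within time R, continuous (fun t => f t i ord0)}.
  rewrite (_ : (fun t => _) = fun t => \int[mu]_(s in `[0, t])
    ((A' s - A s) *m x s + (B' s - B s) *m u s) i ord0).
    exact: time_continuous_integral.
  by apply/funext => t; rewrite fE.
have [w [cw wE w_bound]] := volterra_solution A'K cf.
have lw j : segment_integrable (fun t => w t j ord0).
  exact/time_continuous_segment_integrable/cw.
exists (fun t => x t + w t); split.
- move=> i; rewrite (_ : (fun t => _) = fun t => x t i ord0 + w t i ord0).
    by move=> t; apply: cvgD; [exact: cx|exact: cw].
  by apply/funext => t; rewrite mxE.
- move=> t i t0; rewrite mxE xE// wE// fE addrA -RintegralD//; last 2 first.
  + exact: (segment_integrable_field i AK BK lx lu t).
  + exact: (ldiff i t).
  rewrite -RintegralD//; last 2 first.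
  + apply: (segment_integrableD _ (ldiff i)).
    exact: (segment_integrable_field i AK BK lx lu).
  + exact: segment_integrable_mulmx A'K lw t.
  apply: eq_Rintegral => s _.
  rewrite (_ : A' s *m _ + _ = (A s *m x s + B s *m u s) +
    ((A' s - A s) *m x s + (B' s - B s) *m u s) + A' s *m w s).
    by rewrite [RHS]mxE [X in _ = X + _]mxE.
  by rewrite !mulmxBl mulmxDr addrACA ![_ *m _ + (_ - _)]addrC !subrK addrAC.
- move=> T G fG t i t0T; rewrite mxE addrAC subrr add0r.
  by apply: w_bound t0T => s j s0T; rewrite fE; exact: fG.
Qed.

(** The Gronwall factor depends on [K] and on the horizon but not on [k], so it suffices that the
    integrated defect of [x] in the [k]-th equation tends to 0, which is dominated convergence. *)
Lemma cvg_trajectories (A_ : nat -> R -> 'M[R]_n)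
    (B_ : nat -> R -> 'M[R]_(n, m)) :
  (forall k, bounded_coefficients K (A_ k)) ->
  (forall k, bounded_coefficients K (B_ k)) ->
  {ae mu, forall t, time R t ->
    forall i j, A_ k t i j @[k --> \oo] --> A t i j} ->
  {ae mu, forall t, time R t ->
    forall i j, B_ k t i j @[k --> \oo] --> B t i j} ->
  exists z : nat -> R -> 'cV[R]_n,
  [/\ forall k i, {within time R, continuous (fun t => z k t i ord0)},
      forall k t i, 0 <= t -> z k t i ord0 =
        \int[mu]_(s in `[0, t]) (A_ k s *m z k s + B_ k s *m u s) i ord0 &
      forall t i, 0 <= t -> z k t i ord0 @[k --> \oo] --> x t i ord0].
Proof.
move=> A_K B_K cA cB.
have [z zP] := choice (fun k => perturbed_trajectory (A_K k) (B_K k)).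
exists z; split; [by move=> k; have [] := zP k|by move=> k; have [] := zP k|].
move=> T i0 T0.
pose h k i s := ((A_ k s - A s) *m x s + (B_ k s - B s) *m u s) i ord0.
have lh k i : segment_integrable (h k i).
  by apply: (segment_integrable_field _ (bounded_coefficientsB (A_K k) AK)
    (bounded_coefficientsB (B_K k) BK)).
(* Integrating absolute values over all of [[0, T]] and summing over coordinates gives one bound
   valid for every earlier time and every coordinate. *)
pose G k := \sum_i \int[mu]_(s in `[0, T]) `|h k i s|.
have hG k t i : 0 <= t <= T -> `|\int[mu]_(s in `[0, t]) h k i s| <= G k.
  move=> /andP[t0 tT]; rewrite (le_trans (le_normr_Rintegral _ _))//.
    exact: lh.
  rewrite (@le_trans _ _ (\int[mu]_(s in `[0, T]) `|h k i s|))//.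
    rewrite fine_le//.
    - exact/integrable_fin_num/integrable_norm/lh.
    - exact/integrable_fin_num/integrable_norm/lh.
    apply: ge0_subset_integral => //.
    - apply/measurable_EFinP/measurableT_comp => //.
      exact: segment_integrable_measurable.
    - by apply: subset_itvl; rewrite bnd_simp.
  rewrite /G (bigD1 i)//= lerDl sumr_ge0// => j _.
  by apply: Rintegral_ge0.
have h0 i : {ae mu, forall s, `[0, T]%classic s ->
    `|h k i s| @[k --> \oo] --> (0 : R)}.
  apply: (@filterS2 _ _ (ae_filter_ringOfSetsType mu) _ _ _ _ cA cB).
  move=> s cAs cBs /time_segment s0.
  suff hs : h k i s @[k --> \oo] --> (0 : R).
    by rewrite -(@normr0 _ R); exact: cvg_norm.
  rewrite (_ : 0 = ((0 : 'M[R]_n) *m x s) i ord0 +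
    ((0 : 'M[R]_(n, m)) *m u s) i ord0); last first.
    by rewrite !mul0mx !mxE addr0.
  rewrite /h; under eq_cvg do rewrite mxE.
  have cv0 p q (a_ : nat -> 'M[R]_(p, q)) (a : 'M[R]_(p, q))
      (v : 'cV[R]_q) l :
      (forall j, a_ k l j @[k --> \oo] --> a l j) ->
      ((a_ k - a) *m v) l ord0 @[k --> \oo] -->
      ((0 : 'M[R]_(p, q)) *m v) l ord0.
    move=> ca; apply: (@cvg_mulmx _ _ _ (fun=> v) _ (fun k => a_ k - a)) => j.
      rewrite (_ : (fun k => _) = fun k => a_ k l j - a l j); last first.
        by apply/funext => k; rewrite !mxE.
      rewrite mxE -(subrr (a l j)); apply: cvgB; first exact: ca.
      exact: cvg_cst.
    exact: cvg_cst.
  apply: cvgD.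
    by apply: (cv0 _ _ (fun k => A_ k s)) => j; exact: cAs.
  by apply: (cv0 _ _ (fun k => B_ k s)) => j; exact: cBs.
have G0 : G k @[k --> \oo] --> 0.
  rewrite (_ : 0 = \sum_(i < n) \int[mu]_(s in `[0, T]) (0 : R)); last first.
    by rewrite big1// => i _; rewrite Rintegral_cst// mul0r.
  apply: cvg_sumr => i.
  (* Differences of coefficients are at most [K *+ 2], while [x] and [u] are independent of [k] and
     integrable on segments. *)
  apply: (@Rintegral_dominated_cvg _ _ _ mu _ _ _ (fun s =>
    K *+ 2 * (\sum_j `|x s j ord0|) + K *+ 2 * (\sum_j `|u s j ord0|))).
  - exact: measurable_itv.
  - move=> k; apply: measurableT_comp => //.
    exact: segment_integrable_measurable.
  - exact: measurable_cst.
  - exact: h0.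
  - by apply: segment_integrableD; exact: segment_integrable_sum_norm.
  - move=> k s /time_segment; rewrite timeE => s0; rewrite normr_id /h mxE.
    rewrite (le_trans (ler_normD _ _))// lerD// norm_mulmx_sum_le// => j.
      by have [_] := bounded_coefficientsB (A_K k) AK i j; apply.
    by have [_] := bounded_coefficientsB (B_K k) BK i j; apply.
have : 2 * G k * expR (n%:R * K *+ 2 * T) @[k --> \oo] --> 0.
  rewrite (_ : 0 = 2 * 0 * expR (n%:R * K *+ 2 * T)); last first.
    by rewrite mulr0 mul0r.
  by apply: cvgM; [apply: cvgM => //; exact: cvg_cst|exact: cvg_cst].
move=> bound0.
have zx : `|z k T i0 ord0 - x T i0 ord0| @[k --> \oo] --> (0 : R).
  apply: (squeeze_cvgr _ (cvg_cst 0) bound0).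
  apply: nearW => k; rewrite normr_ge0/=.
  have [_ _ /(_ T (G k))] := zP k; apply; last by rewrite T0/=.
  exact: hG.
by apply/subr_cvg0; exact: norm_cvg0 zx.
Qed.

End perturbation.

(** * Slowing down and freezing signals *)

Section signals.
Context {R : realType} {V : topologicalType}.
Implicit Types (sigma : R -> V) (M : set V) (tau c T : R).

(** Continuity of a signal is relative to the half-line, so a change of time can be composed with it
    only once it is known to stay nonnegative. *)
Lemma cvg_to_within (I : Type) (F : set_system I) (D : set R) (f : I -> R)
    (l : R) :
  Filter F -> f x @[x --> F] --> l -> (\forall x \near F, D (f x)) ->
  f x @[x --> F] --> within D (nbhs l).
Proof.
move=> FF fl Df A wA; change (\forall x \near F, A (f x)).
have fA : \forall x \near F, D (f x) -> A (f x) := fl _ wA.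
by apply: filterS2 Df fA => x Dx; exact.
Qed.

Lemma countable_switching_times sigma :
  piecewise_constant sigma -> countable (switching_times sigma).
Proof.
move=> pc.
rewrite (_ : switching_times sigma =
    \bigcup_(k in [set: nat]) (switching_times sigma `&` `[0, k%:R])).
  apply: bigcup_countable => // k _; apply: finite_set_countable.
  by have [] := pc k%:R.
apply/seteqP; split=> [t st|t [k _ []]//].
have [+ _] := st; rewrite timeE => t0.
exists (Num.truncn t).+1 => //; split => //=.
by rewrite in_itv/= t0/= ltW// truncnS_gt.
Qed.

Lemma countable_measurable_fun (D : set R) (f : R -> R) :
  countable D -> measurable_fun D f.
Proof.
move=> cD mD Y mY; apply: countable_measurable => //.
exact: sub_countable (subset_card_le (@subIsetl _ _ _)) cD.
Qed.

(** The half-line splits into the countable set of switching times, on which every function is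
    measurable, and its complement, on which the composite is continuous. *)
Lemma signal_measurable sigma (h : V -> R) : piecewise_constant sigma ->
  continuous h -> measurable_fun (time R) (h \o sigma).
Proof.
move=> /countable_switching_times cS ch.
have mS : measurable (switching_times sigma).
  exact: countable_measurable cS.
rewrite -(@setDUK _ (switching_times sigma) (time R)); last by move=> t [].
apply/measurable_funU => //.
  exact: measurableD.
split; first exact: countable_measurable_fun.
apply: subspace_continuous_measurable_fun; first exact: measurableD.
apply/subspace_continuousP => t [tR tS].
apply: (@cvg_comp _ _ _ sigma h _ (nbhs (sigma t))); last exact: ch.
have : sigma s @[s --> within (time R) (nbhs t)] --> sigma t.
  by apply: contrapT => /(conj tR).
apply: cvg_trans; apply: cvg_app; apply: within_subset.
by move=> s [].
Qed.

Definition clip c T t := Num.min (c * t) T.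

Lemma clip_time c T t : 0 <= c -> 0 <= T -> 0 <= t -> 0 <= clip c T t.
Proof. by move=> c0 T0 t0; rewrite /clip le_min T0 mulr_ge0. Qed.

Lemma continuous_clip c T : continuous (clip c T).
Proof.
move=> t; apply: continuous_min; last exact: cvg_cst.
exact: mulrl_continuous.
Qed.

(** Where [c * t > T] the new signal is locally constant; elsewhere continuity of [sigma] at [c * t]
    passes to the composite. A switching at [c * t = T] may disappear, hence only one
    implication. *)
Lemma switching_times_clip c T sigma t : 0 < c -> 0 <= T ->
  switching_times (sigma \o clip c T) t ->
  switching_times sigma (c * t) /\ c * t <= T.
Proof.
move=> c0 T0 []; rewrite timeE => t0 st.
have ct0 : 0 <= c * t by rewrite mulr_ge0 ?(ltW c0).
have [ctT|Tct] := leP (c * t) T; last first.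
  exfalso; apply: st => /=.
  have cE : \forall s \near within (time R) (nbhs t), clip c T s = T.
    apply: cvg_within; near=> s; apply/min_idPr/ltW.
    near: s; have : c * s @[s --> t] --> c * t by exact: mulrl_continuous.
    by move/cvgr_gt; apply.
  rewrite {2}/clip (min_idPr (ltW Tct)).
  apply: cvg_near_cst; apply: filterS cE => s sT.
  by rewrite sT.
split => //; split; first by rewrite timeE.
apply: contra_not st => st.
have ctE : clip c T t = c * t by apply/min_idPl.
rewrite -ctE in st.
apply: (@cvg_comp _ _ _ (clip c T) sigma _ _ _ _ st).
apply: cvg_to_within; first by apply: cvg_within_filter; exact: continuous_clip.
near=> s; rewrite timeE clip_time ?(ltW c0)//.
have : time R s by near: s; exact: withinT.
by rewrite timeE.
Unshelve. all: by end_near. Qed.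

(** Finitely many positive distances have a positive lower bound. This provides a positive dwell
    time when the original one is 0. *)
Lemma finite_set_min_gap (F : set R) : finite_set F ->
  exists2 delta : R, 0 < delta & forall s t, F s -> F t -> s != t ->
    delta <= `|s - t|.
Proof.
have min_seq (l : seq R) : {in l, forall x, 0 < x} ->
    exists2 delta : R, 0 < delta & {in l, forall x, delta <= x}.
  elim: l => [|x l IH] l_gt0; first by exists 1.
  have [y yl|delta delta0 dl] := IH.
    by apply: l_gt0; rewrite inE yl orbT.
  exists (Num.min x delta).
    by rewrite lt_min delta0 l_gt0// mem_head.
  move=> y; rewrite inE => /predU1P[->|yl]; first by rewrite ge_min lexx.
  by rewrite ge_min dl ?orbT.
move=> /finite_seqP[r ->].
have [|delta delta_gt0 le_gaps] := min_seq
    [seq `|p.1 - p.2| | p <- allpairs pair r r & p.1 != p.2].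
  move=> _ /mapP[p + ->]; rewrite mem_filter => /andP[neq _].
  by rewrite normr_gt0 subr_eq0.
exists delta => // s t /= sr tr st; apply: le_gaps.
apply/mapP; exists (s, t) => //.
by rewrite mem_filter st/=; apply/allpairsP; exists (s, t).
Qed.

Lemma dwell_time_clip c T tau M sigma : 0 < c < 1 -> 0 <= T -> 0 <= tau ->
  dwell_time_signals tau M sigma ->
  exists2 tau', tau < tau' & dwell_time_signals tau' M (sigma \o clip c T).
Proof.
move=> /andP[c0 c1] T0 tau0 [pc Ms dw].
have [delta delta0 dP] := finite_set_min_gap (proj1 (pc T)).
have sub t : switching_times (sigma \o clip c T) t ->
    (switching_times sigma `&` `[0, T]) (c * t).
  move=> st; have [sct ctT] := switching_times_clip c0 T0 st.
  split => //; rewrite /= in_itv/= ctT andbT.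
  by case: sct; rewrite timeE.
(* Slowing down divides all gaps by [c < 1]. For [tau > 0] already [tau / c] exceeds [tau]; for
   [tau = 0] the minimal gap [delta] gives the strict increase. *)
exists (Num.max delta tau / c).
  rewrite ltr_pdivlMr//.
  have [->|tau_neq0] := eqVneq tau 0; first by rewrite mul0r lt_max delta0.
  rewrite lt_max; apply/orP; right; rewrite gtr_pMr// lt0r tau_neq0//.
split.
- move=> T'; split.
    apply: (@sub_finite_set _ _
      ((fun s => s / c) @` (switching_times sigma `&` `[0, T]))).
      move=> t [/sub st _]; exists (c * t) => //.
      by rewrite mulrC mulKf// gt_eqF.
    by apply: finite_image; have [] := pc T.
  apply: (@sub_finite_set _ _ (sigma @` `[0, T])); last by have [] := pc T.
  move=> _ [t + <-] => /time_segment; rewrite timeE => t0.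
  exists (clip c T t) => //=.
  by rewrite in_itv/= clip_time ?(ltW c0)//= /clip ge_min lexx orbT.
- move=> t; rewrite timeE => t0; apply: Ms.
  by rewrite timeE clip_time ?(ltW c0).
move=> s t ss st sneqt.
rewrite ler_pdivrMr// -[X in _ * X](gtr0_norm c0) -normrM mulrBl ![_ * c]mulrC.
have [ss1 ss2] := sub _ ss; have [st1 st2] := sub _ st.
have csneqct : c * s != c * t by rewrite (inj_eq (mulfI _))// gt_eqF.
by rewrite ge_max dP//= dw.
Qed.

(** The index is shifted because [harmonic 0 = 1] would give the ratio 0, which stops time. *)
Definition clip_ratio k : R := 1 - harmonic k.+1.

Lemma clip_ratio_itv k : 0 < clip_ratio k < 1.
Proof.
rewrite /clip_ratio subr_gt0 gtrBl harmonic_gt0 andbT/=.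
by rewrite invf_lt1// ltr1n.
Qed.

Lemma cvg_clip_ratio t : 0 <= t ->
  clip (clip_ratio k) k%:R t @[k --> \oo] --> t.
Proof.
move=> t0.
have ct : clip_ratio k * t @[k --> \oo] --> t.
  rewrite -[X in _ --> X]mul1r; apply: cvgM; last exact: cvg_cst.
  rewrite -[X in _ --> X]subr0; apply: cvgB; first exact: cvg_cst.
  by rewrite (cvg_shiftS (@harmonic R)); exact: cvg_harmonic.
(* Once [k] exceeds [t], the freezing time [k] is not yet reached and only the slowing down acts at
   [t]. *)
apply: cvg_trans ct; apply: near_eq_cvg; near=> k.
apply/esym/min_idPl.
rewrite (@le_trans _ _ t)//.
  by rewrite ler_piMl//; have /andP[_ /ltW] := clip_ratio_itv k.
rewrite (@le_trans _ _ (Num.truncn t).+1%:R)//.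
  by rewrite ltW// truncnS_gt.
by rewrite ler_nat; near: k; exact: nbhs_infty_ge.
Unshelve. all: by end_near. Qed.

Lemma cvg_clipped_signal sigma t : time R t -> ~ switching_times sigma t ->
  sigma (clip (clip_ratio k) k%:R t) @[k --> \oo] --> sigma t.
Proof.
move=> tR st.
have cs : sigma s @[s --> within (time R) (nbhs t)] --> sigma t.
  by apply: contrapT => /(conj tR).
apply: (@cvg_comp _ _ _ (fun k => clip (clip_ratio k) k%:R t) sigma _ _ _ _ cs).
rewrite timeE in tR.
apply: cvg_to_within; first exact: cvg_clip_ratio.
apply: nearW => k; rewrite timeE clip_time//.
by have /andP[/ltW] := clip_ratio_itv k.
Qed.

End signals.

(** * Lower semicontinuity of the [L_2] norm *)

Section L2_norms.
Context {R : realType}.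
Local Notation mu := (@lebesgue_measure R).

Lemma limn_einf_le (u : (\bar R)^nat) (C : \bar R) :
  (forall k, u k <= C)%E -> (limn_einf u <= C)%E.
Proof.
move=> uC; rewrite limn_einf_lim; apply: lime_le; first exact: is_cvg_einfs.
apply: nearW => k; apply: (le_trans _ (uC k)).
by apply: ereal_inf_lbound; exists k => /=.
Qed.

Lemma fatou_le d (T : measurableType d) (nu : {measure set T -> \bar R})
    (D : set T) (f_ : nat -> T -> \bar R) (f : T -> \bar R) (C : \bar R) :
  measurable D ->
  (forall k, measurable_fun D (f_ k)) -> measurable_fun D f ->
  (forall k t, D t -> 0 <= f_ k t)%E -> (forall t, D t -> 0 <= f t)%E ->
  {ae nu, forall t, D t -> f_ k t @[k --> \oo] --> f t} ->
  (forall k, \int[nu]_(t in D) f_ k t <= C)%E ->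
  (\int[nu]_(t in D) f t <= C)%E.
Proof.
move=> mD mf_ mf f_0 f0 [N [mN N0 DN]] f_C.
(* Discarding the null set [N] leaves points where [f] is the lower limit of the [f_ k]. *)
rewrite (ge0_negligible_integral mN)//.
have mDN : measurable (D `\` N) by exact: measurableD.
rewrite (eq_integral (fun t => limn_einf (f_ ^~ t))); last first.
  move=> t; rewrite inE => -[Dt Nt].
  have ft : f_ k t @[k --> \oo] --> f t.
    by apply: contrapT => nft; apply/Nt/DN => /= /(_ Dt).
  by have [-> _] := cvg_limn_einf_sup ft.
apply: (le_trans (fatou _ _ _ _)) => //.
- by move=> k; apply: measurable_funS (mf_ k).
- by move=> k t [Dt _]; exact: f_0.
apply: limn_einf_le => k; apply: (le_trans _ (f_C k)).
apply: ge0_subset_integral => //.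
by move=> t Dt; exact: f_0.
Qed.

Lemma euclidean_norm_sqr k (v : 'cV[R]_k) :
  euclidean_norm v ^+ 2 = \sum_i v i ord0 ^+ 2.
Proof. by rewrite sqr_sqrtr// sumr_ge0// => i _; exact: sqr_ge0. Qed.

(** Squared norms are integrals of nonnegative functions, the form in which Fatou's lemma and the
    criterion for a vanishing integral apply. *)
Lemma L2_norm_sqr k (f : R -> 'cV[R]_k) :
  (L2_norm f `^ 2)%E =
  (\int[mu]_(t in time R) (\sum_i f t i ord0 ^+ 2)%:E)%E.
Proof.
rewrite poweR_Lnorm// [RHS]integral_mkcond; apply: eq_integral => t _ /=.
rewrite patchE; case: ifPn => tR; rewrite patchE ?(negbTE tR) ?tR/=.
  by rewrite powR_mulrn// real_normK ?num_real// euclidean_norm_sqr.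
by rewrite normr0 powR0.
Qed.

Lemma measurable_sqr_sum k (f : R -> 'cV[R]_k) (D : set R) :
  (forall i, measurable_fun D (fun t => f t i ord0)) ->
  measurable_fun D (fun t => \sum_i f t i ord0 ^+ 2).
Proof.
by move=> mf; apply: measurable_sum => i; exact: measurable_funX.
Qed.

Lemma L2_norm_le_lim k (f_ : nat -> R -> 'cV[R]_k) (f : R -> 'cV[R]_k)
    (C : \bar R) :
  (forall l i, measurable_fun (time R) (fun t => f_ l t i ord0)) ->
  (forall i, measurable_fun (time R) (fun t => f t i ord0)) ->
  {ae mu, forall t, time R t ->
    forall i, f_ l t i ord0 @[l --> \oo] --> f t i ord0} ->
  (forall l, L2_norm (f_ l) <= C)%E -> (L2_norm f <= C)%E.
Proof.
move=> mf_ mf cf f_C.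
have C0 : (0 <= C)%E by apply: le_trans (f_C 0%N); exact: Lnorm_ge0.
(* Squares are compared instead; the power 1/2, monotone on the nonnegative extended reals, undoes
   the squaring even if [C] is infinite. *)
suff : (L2_norm f `^ 2 <= C `^ 2)%E.
  have two_ge0 : (0 : R) <= 2^-1 by rewrite invr_ge0.
  move/(gt0_ler_poweR two_ge0); rewrite !in_itv/= !leey !poweR_ge0.
  by rewrite -!poweRrM mulfV// !poweRe1//; [apply|exact: Lnorm_ge0].
rewrite L2_norm_sqr; apply: (@fatou_le _ _ mu _
  (fun l t => (\sum_i f_ l t i ord0 ^+ 2)%:E)) => //.
- by move=> l; apply/measurable_EFinP; exact: measurable_sqr_sum.
- by apply/measurable_EFinP; exact: measurable_sqr_sum.
- by move=> l t _; rewrite lee_fin sumr_ge0// => i _; exact: sqr_ge0.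
- by move=> t _; rewrite lee_fin sumr_ge0// => i _; exact: sqr_ge0.
- apply: (@filterS _ _ (ae_filter_ringOfSetsType mu) _ _ _ cf) => t cft tR.
  apply: cvg_EFin; first exact: nearW.
  apply: cvg_sumr => i; apply: (@cvg_comp _ _ _ _ (fun x : R => x ^+ 2)).
    exact: cft.
  exact: exprn_continuous.
move=> l; rewrite -L2_norm_sqr gt0_ler_poweR// in_itv/= leey andbT//.
exact: Lnorm_ge0.
Qed.

(** If the integral of the sum of squares is 0, the sum vanishes almost everywhere, and each entry
    with it. This makes the denominator of a gain ratio positive. *)
Lemma L2_norm_gt0 k (f : R -> 'cV[R]_k) :
  (forall i, measurable_fun (time R) (fun t => f t i ord0)) ->
  ~ {ae mu, forall t, time R t -> f t = 0} -> (0 < L2_norm f)%E.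
Proof.
move=> mf nf; rewrite lt0e; apply/andP; split; last exact: Lnorm_ge0.
apply/eqP => f0; apply: nf.
have int0 : (\int[mu]_(t in time R) `|(\sum_i f t i ord0 ^+ 2)%:E| = 0)%E.
  rewrite -[RHS](@poweR0r _ 2)// -f0 L2_norm_sqr; apply: eq_integral => t _.
  by rewrite gee0_abs// lee_fin sumr_ge0// => i _; exact: sqr_ge0.
have mf2 : measurable_fun (time R) (fun t => (\sum_i f t i ord0 ^+ 2)%:E).
  by apply/measurable_EFinP; exact: measurable_sqr_sum.
have := (ae_eq_integral_abs mu (measurable_itv _) mf2).1 int0.
move=> ae0; apply: (@filterS _ _ (ae_filter_ringOfSetsType mu) _ _ _ ae0).
move=> t /= /[apply] -[] /eqP; rewrite psumr_eq0 => [/allP f0t|i _]; last first.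
  exact: sqr_ge0.
apply/matrixP => i j; rewrite ord1 mxE; apply/eqP.
by have := f0t i (mem_index_enum i); rewrite /= expf_eq0.
Qed.

(** The absolute value of an entry is at most 1 plus its square, and constants are integrable on
    bounded segments. *)
Lemma in_L2_segment_integrable k (f : R -> 'cV[R]_k) i :
  in_L2 f -> segment_integrable (fun t => f t i ord0).
Proof.
move=> [mf foo] T.
have mS : mu.-integrable (time R) (EFin \o (fun t => \sum_j f t j ord0 ^+ 2)).
  apply/integrableP; split.
    by apply/measurable_EFinP; exact: measurable_sqr_sum.
  under eq_integral => t _.
    rewrite gee0_abs/=; last first.
      by rewrite lee_fin sumr_ge0// => j _; exact: sqr_ge0.
    over.
  by rewrite -L2_norm_sqr poweR_lty.
have i1S : mu.-integrable `[0, T]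
    (EFin \o (fun t => 1 + \sum_j f t j ord0 ^+ 2)).
  rewrite (_ : EFin \o _ = ((EFin \o cst 1%R) \+
    (EFin \o (fun t => \sum_j f t j ord0 ^+ 2)%R))%E)//.
  apply: integrableD => //; last first.
    by apply: integrableS mS => //; exact: time_segment.
  apply: continuous_compact_integrable; first exact: segment_compact.
  by apply: continuous_subspaceT => s; exact: cvg_cst.
apply: le_integrable i1S => //.
  apply/measurable_EFinP; apply: measurable_funS (mf i) => //.
  exact: time_segment.
move=> t _; rewrite /= lee_fin (@le_trans _ _ (1 + f t i ord0 ^+ 2))//.
  rewrite -real_normK ?num_real//.
  set a := `|f t i ord0|.
  have a0 : 0 <= a by rewrite /a.
  by have := sqr_ge0 (a - 1); nra.
rewrite ger0_norm; last by rewrite addr_ge0// sumr_ge0// => j _; exact: sqr_ge0.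
rewrite lerD2l (bigD1 i)//= lerDl sumr_ge0// => j _; exact: sqr_ge0.
Qed.

End L2_norms.

(** * The gain *)

Section gain.
Context {R : realType}.
Local Notation mu := (@lebesgue_measure R).
Variables n m p : nat.
Local Notation system := ('M[R]_n * 'M[R]_(n, m) * 'M[R]_(p, n))%type.
Implicit Types (S : system) (sigma : R -> system) (M : set system).

Lemma time_continuous_entries k (x : R -> 'cV[R]_k) :
  {within time R, continuous x} <->
  forall i, {within time R, continuous (fun t => x t i ord0)}.
Proof.
split=> [cx i|cx].
  move=> t; apply: (@cvg_comp _ _ _ x (fun v : 'cV[R]_k => v i ord0)).
    exact: cx.
  exact: coord_continuous.
apply/subspace_continuousP => t t0 A [P xP PA].
have : \forall s \near within (time R) (nbhs t),
    forall i, P i ord0 (x s i ord0).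
  apply: filter_forall => i.
  have /subspace_continuousP /(_ t t0) := cx i.
  by apply; exact: xP.
by apply: filterS => s Ps; apply: PA => i j; rewrite ord1.
Qed.

Lemma entry_le_mx_norm k l (a : 'M[R]_(k, l)) i j : `|a i j| <= `|a|.
Proof.
rewrite [leRHS]/Num.norm/= mx_normrE.
exact: (le_bigmax _ (fun ij => `|a ij.1 ij.2|) (i, j)).
Qed.

Definition bounded_system K S :=
  [/\ forall i j, `|matA S i j| <= K, forall i j, `|matB S i j| <= K &
      forall i j, `|matC S i j| <= K].

(** The norm of a triple is the maximum over its components and that of a matrix the maximum over
    its entries, so one constant controls every coefficient. *)
Lemma bounded_set_system M : bounded_set M ->
  exists K, forall S, M S -> bounded_system K S.
Proof.
move=> [K [_ /(_ (K + 1))]]; rewrite ltrDl => /(_ ltr01) MK.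
exists (K + 1) => S /MK /=; rewrite !prod_normE !ge_max.
move=> /andP[/andP[AK BK] CK].
by split=> i j; apply: le_trans (entry_le_mx_norm _ _ _) _.
Qed.

Lemma matA_continuous i j : continuous (fun S => matA S i j).
Proof.
move=> S; apply: (@cvg_comp _ _ _ (fun S => matA S) (fun a => a i j)).
  by apply: (@cvg_comp _ _ _ fst fst); exact: cvg_fst.
exact: coord_continuous.
Qed.

Lemma matB_continuous i j : continuous (fun S => matB S i j).
Proof.
move=> S; apply: (@cvg_comp _ _ _ (fun S => matB S) (fun a => a i j)).
  by apply: (@cvg_comp _ _ _ fst snd); [exact: cvg_fst|exact: cvg_snd].
exact: coord_continuous.
Qed.

Lemma matC_continuous i j : continuous (fun S => matC S i j).
Proof.
move=> S; apply: (@cvg_comp _ _ _ (fun S => matC S) (fun a => a i j)).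
  exact: cvg_snd.
exact: coord_continuous.
Qed.

Lemma bounded_coefficients_signal K sigma : piecewise_constant sigma ->
  (forall t, time R t -> bounded_system K (sigma t)) ->
  [/\ bounded_coefficients K (fun t => matA (sigma t)),
      bounded_coefficients K (fun t => matB (sigma t)) &
      bounded_coefficients K (fun t => matC (sigma t))].
Proof.
move=> pc bs; split=> i j; split.
- exact: signal_measurable pc (@matA_continuous i j).
- by move=> t t0; have [] := bs t; rewrite ?timeE.
- exact: signal_measurable pc (@matB_continuous i j).
- by move=> t t0; have [] := bs t; rewrite ?timeE.
- exact: signal_measurable pc (@matC_continuous i j).
- by move=> t t0; have [] := bs t; rewrite ?timeE.
Qed.

(** A longer dwell time admits fewer signals. *)
Lemma L2_gain_nonincreasing M : nonincreasing_fun (L2_gain M).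
Proof.
move=> tau tau' tt'; rewrite /L2_gain ge_max le_max lexx/= le_max.
apply/orP; right; apply: ereal_sup_le => r.
move=> [u [sigma [x [uL2 u0 [pc Ms dw] tr ->]]]].
exists u, sigma, x; split => //; split => // s t ss st st'.
by rewrite (le_trans tt')// dw.
Qed.

Lemma measurable_output K sigma (x : R -> 'cV[R]_n) i :
  bounded_coefficients K (fun t => matC (sigma t)) ->
  (forall j, {within time R, continuous (fun t => x t j ord0)}) ->
  measurable_fun (time R) (fun t => output sigma x t i ord0).
Proof.
move=> CK cx.
rewrite (_ : (fun t => _) =
    fun t => \sum_j matC (sigma t) i j * x t j ord0); last first.
  by apply/funext => t; rewrite mxE.
apply: measurable_sum => j; apply: measurable_funM; first by have [] := CK i j.
exact: time_continuous_measurable.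
Qed.

Lemma L2_ratio_le_right M tau r : bounded_set M -> 0 <= tau ->
  L2_ratios M tau r ->
  (r <= ereal_sup [set L2_gain M tau' | tau' in `]tau, +oo[])%E.
Proof.
move=> bM tau0 [u [sigma [x [uL2 u0 dw [cx xE] ->]]]].
set C := ereal_sup _.
have [K MK] := bounded_set_system bM.
have [pc Msigma _] := dw.
have lu j := in_L2_segment_integrable j uL2.
have [AK BK CK] :=
  bounded_coefficients_signal pc (fun t tR => MK _ (Msigma t tR)).
pose sigma_ k := sigma \o clip (clip_ratio k) k%:R.
have dw_ k : exists tau', tau < tau' /\ dwell_time_signals tau' M (sigma_ k).
  have [tau' ? ?] :=
    dwell_time_clip (clip_ratio_itv k) (ler0n R k) tau0 dw.
  by exists tau'.
have [tau_ tau_P] := choice dw_.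
have bs_ k : [/\ bounded_coefficients K (fun t => matA (sigma_ k t)),
    bounded_coefficients K (fun t => matB (sigma_ k t)) &
    bounded_coefficients K (fun t => matC (sigma_ k t))].
  have [_ [pck Mk _]] := tau_P k.
  by apply: bounded_coefficients_signal pck _ => t /Mk /MK.
have ae_signal : {ae mu, forall t, time R t -> ~ switching_times sigma t}.
  have cS := countable_switching_times pc.
  exists (switching_times sigma); split.
  - exact: countable_measurable cS.
  - exact: countable_lebesgue_measure0.
  - by move=> t /= /not_implyP[_] /contrapT.
have ae_cvg k l (h : system -> 'M[R]_(k, l)) :
    (forall i j, continuous (fun S => h S i j)) ->
    {ae mu, forall t, time R t -> forall i j,
      h (sigma_ q t) i j @[q --> \oo] --> h (sigma t) i j}.
  move=> ch.
  apply: (@filterS _ _ (ae_filter_ringOfSetsType mu) _ _ _ ae_signal).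
  move=> t nst tR i j.
  apply: (@cvg_comp _ _ _ (fun q => sigma_ q t) (fun S => h S i j)).
    by apply: cvg_clipped_signal => //; exact: nst.
  exact: ch.
have cxi := (time_continuous_entries x).1 cx.
have xE0 t i : 0 <= t -> x t i ord0 = \int[mu]_(s in `[0, t])
    (matA (sigma s) *m x s + matB (sigma s) *m u s) i ord0.
  by move=> t0; apply: xE; rewrite timeE.
have A_K k : bounded_coefficients K (fun t => matA (sigma_ k t)).
  by have [] := bs_ k.
have B_K k : bounded_coefficients K (fun t => matB (sigma_ k t)).
  by have [] := bs_ k.
have [z [cz zE zx]] := cvg_trajectories AK BK lu cxi xE0 A_K B_K
  (ae_cvg _ _ _ matA_continuous) (ae_cvg _ _ _ matB_continuous).
have u_gt0 : (0 < L2_norm u)%E by apply: L2_norm_gt0 => //; have [] := uL2.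
have [_ u_fin] := uL2.
(* The denominator is a positive real [N], so the claim becomes a bound by [C * N] on the norm of
   the output, and it suffices to prove this bound for each approximating output. *)
have : L2_norm u \is a fin_num by rewrite ge0_fin_numE// ltW.
move: u_gt0; case NE : (L2_norm u) => [N| |] // N0 _.
rewrite lte_fin in N0.
rewrite inver gt_eqF// lee_pdivrMr//.
apply: (@L2_norm_le_lim _ _ (fun k => output (sigma_ k) (z k))).
- by move=> k i; have [_ _ Ck] := bs_ k; exact: measurable_output Ck (cz k).
- by move=> i; exact: measurable_output CK cxi.
- apply: (@filterS _ _ (ae_filter_ringOfSetsType mu) _ _ _
    (ae_cvg _ _ _ matC_continuous)) => t cCt tR i.
  apply: cvg_mulmx => j; first exact: cCt.
  by apply: zx; rewrite -timeE.
move=> k; rewrite -lee_pdivrMr//.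
have [tauk dwk] := tau_P k.
(* Because [tau_ k > tau] strictly, this gain is one of those over which [C] is the supremum. *)
apply: (@le_trans _ _ (L2_gain M (tau_ k))); last first.
  by apply: ereal_sup_ubound; exists (tau_ k) => //=; rewrite in_itv/= tauk.
rewrite /L2_gain le_max; apply/orP; right; apply: ereal_sup_ubound.
exists u, (sigma_ k), (z k); split => //.
- split; first exact/time_continuous_entries.
  by move=> t; rewrite timeE => t0 i; exact: zE.
- by rewrite NE inver gt_eqF.
Qed.

End gain.

Unset Implicit Arguments.

Theorem proposition32 (R : realType) (n m p : nat)
    (n_gt0 : (0 < n)%N) (m_gt0 : (0 < m)%N) (p_gt0 : (0 < p)%N)
    (M : set ('M[R]_n * 'M[R]_(n, m) * 'M[R]_(p, n))) (bM : bounded_set M)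
    (taubar : R) (taubar_ge0 : 0 <= taubar) :
  L2_gain M tau @[tau --> taubar^'+] --> L2_gain M taubar.
Proof.
(* A nonincreasing function tends from the right to its supremum over larger arguments, so only the
   value of that supremum has to be identified. *)
rewrite (_ : L2_gain M taubar =
    ereal_sup [set L2_gain M tau | tau in `]taubar, +oo[]).
  apply: (nonincreasing_at_right_cvge +oo%O) => // s t _ _.
  exact: L2_gain_nonincreasing.
apply/eqP; rewrite eq_le; apply/andP; split.
  rewrite ge_max; apply/andP; split.
    (* The supremum is nonnegative because it is taken over a nonempty set of nonnegative gains;
       [taubar + 1] is an arbitrary witness. *)
    apply: (@le_trans _ _ (L2_gain M (taubar + 1))).
      by rewrite le_max lexx.
    apply: ereal_sup_ubound; exists (taubar + 1) => //=.
    by rewrite in_itv/= ltrDl ltr01.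
  apply: ge_ereal_sup => r; exact: L2_ratio_le_right.
apply: ge_ereal_sup => _ [tau + <-]; rewrite /= in_itv/= andbT => /ltW.
exact: L2_gain_nonincreasing.
Qed.
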